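(* Let $n \ge 4$ and let $\mathcal{A}$ be a fourth order $n$ dimensional generalized anti-circulant tensor with circulant index $r = 4$ and generating vector $\mathbf{v} = (v_0, \dots, v_{4(n-1)})^\top$. Then $\mathcal{A}$ is PSD if and only if $v_0 = v_2$, $v_1 = v_3$ and $|v_1| \le v_0$. In this case, one may write $v_1 = v_0(2t-1)$ with $t \in [0,1]$, and then the Hankel polynomial $f$ of $\mathcal{A}$ satisfies, for all $\mathbf{x} \in \mathbb{R}^n$, $$f(\mathbf{x}) = t v_0 (x_1 + \cdots + x_n)^4 + (1-t) v_0 \left(x_1 - x_2 + x_3 - \cdots + (-1)^{n-1} x_n\right)^4,$$ and $\mathcal{A}$ is a strong Hankel tensor.
   Context: Let $m, n \ge 2$ and $\mathbf{v} = (v_0, \dots, v_{(n-1)m})^\top \in \mathbb{R}^{(n-1)m+1}$. The $m$th order $n$ dimensional Hankel tensor with generating vector $\mathbf{v}$ is $\mathcal{A} = (a_{i_1 \cdots i_m})$ with $a_{i_1\cdots i_m} = v_{i_1 + \cdots + i_m - m}$ for $i_1, \dots, i_m = 1, \dots, n$. Given $1 \le r \le n$, $\mathcal{A}$ is called a generalized anti-circulant tensor with circulant index $r$ if $v_i = v_{i+r}$ for all $i = 0, \dots, (n-1)m - r$. The Hankel polynomial of $\mathcal{A}$ is $f(\mathbf{x}) = \sum_{i_1, \dots, i_m = 1}^n v_{i_1 + \cdots + i_m - m}\, x_{i_1} \cdots x_{i_m}$ for $\mathbf{x} = (x_1, \dots, x_n)^\top \in \mathbb{R}^n$. Let $m =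 2k$ be even (here $m = 4$, $k = 2$). $\mathcal{A}$ is PSD (positive semi-definite) if $f(\mathbf{x}) \ge 0$ for all $\mathbf{x} \in \mathbb{R}^n$. The associated Hankel matrix is the $(nk-k+1)\times(nk-k+1)$ matrix $A = (a_{ij})$ with $a_{ij} = v_{i+j-2}$ for $i, j = 1, \dots, nk-k+1$. $\mathcal{A}$ is a strong Hankel tensor if $A$ is positive semi-definite. *)

(* Defs.v *)
From HB Require Import structures.
From mathcomp Require Import all_boot all_order all_algebra.
From mathcomp Require Import reals.

Set Implicit Arguments.
Unset Strict Implicit.
Unset Printing Implicit Defensive.

Import Order.TTheory GRing.Theory Num.Theory.
Local Open Scope ring_scope.

(* Real tensors of order m and dimension n. Indices are 0-based: the value *)
(* i j : 'I_n stands for the usual index i_j minus 1.                      *)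
Definition tensor (R : Type) (m n : nat) := {ffun {ffun 'I_m -> 'I_n} -> R}.

Section Tensor.
Variables (R : realType) (m n : nat).

Definition tensor_poly (A : tensor R m n) (x : 'cV[R]_n) : R :=
  \sum_(i : {ffun 'I_m -> 'I_n}) A i * \prod_(j < m) x (i j) 0.

Definition psd_tensor (A : tensor R m n) : Prop :=
  forall x : 'cV[R]_n, 0 <= tensor_poly A x.

End Tensor.

Definition psd_matrix (R : realType) (N : nat) (M : 'M[R]_N) : Prop :=
  M^T = M /\ forall y : 'cV[R]_N, 0 <= (y^T *m M *m y) 0 0.

(* The entry v_k; only meaningful for k <= N, since inord sends any other k *)
(* to 0. All uses below stay in range.                                      *)
Definition entry (R : realType) (N : nat) (v : 'cV[R]_N.+1) (k : nat) : R :=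
  v (inord k) 0.

Section Hankel.
Variables (R : realType) (m n : nat).
Implicit Type v : 'cV[R]_(n.-1 * m).+1.

(* With 0-based indices, i_1 + ... + i_m - m becomes the plain sum. *)
Definition hankel_tensor v : tensor R m n :=
  [ffun i : {ffun 'I_m -> 'I_n} => entry v (\sum_(j < m) i j)].

Definition hankel_poly v (x : 'cV[R]_n) : R := tensor_poly (hankel_tensor v) x.

Definition generalized_anticirculant (r : nat) v : Prop :=
  (1 <= r <= n)%N /\
  forall i : nat, (i + r <= n.-1 * m)%N -> entry v i = entry v (i + r).

(* For m = 2k and n > 0 the order is (n - 1)k + 1 = nk - k + 1. *)
Definition hankel_matrix v : 'M[R]_((n.-1 * m./2).+1) :=
  \matrix_(i, j) entry v (i + j).

Definition strong_hankel v : Prop := ~~ odd m /\ psd_matrix (hankel_matrix v).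

End Hankel.

(* Main.v *)
Require Import Defs.
From HB Require Import structures.
From mathcomp Require Import all_boot all_order all_algebra.
From mathcomp Require Import reals.
From mathcomp Require Import ring lra zify.

(** A Hankel form is a moment form in disguise. Let L be the linear functional
    on polynomials that sends X^k to v_k, and let P be the polynomial with
    coefficient vector x. Then the Hankel polynomial at x is L(P^m), and the
    quadratic form of the associated Hankel matrix at y is L(Q^2), where Q has
    coefficient vector y ([hankel_poly_moment], [hankel_matrix_moment]).

    The sequence v may be taken 4-periodic on all of nat, so L factors through
    R[X]/(X^4 - 1), and X^4 - 1 = (X - 1)(X + 1)(X^2 + 1).

    Necessity of v_0 = v_2 and v_1 = v_3: the multiples of 1 - X^2 see only the
    factor X^2 + 1. On P = (1 - X^2)(p + qX), whose degree 3 is below n, the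
    form equals 8 Re((w_0 - i w_1)(p + iq)^4) with w_k = v_k - v_{k+2}
    ([moment_antiperiodic_quartic]). A fourth power takes all complex
    arguments, so nonnegativity forces w_0 = w_1 = 0.

    Once w_0 = w_1 = 0, the sequence v is 2-periodic and L is a combination of
    the evaluations at 1 and -1 with weights (v_0 + v_1)/2 and (v_0 - v_1)/2
    ([moment_period2]). Hence L(P^4) and L(Q^2) are the same combinations of
    the fourth powers of P(1), P(-1) and of the squares of Q(1), Q(-1). The
    polynomials X + 1 and X - 1 isolate the weights, so the form is nonnegative
    exactly when both weights are, that is when |v_1| <= v_0; the Hankel matrix
    is then positive semi-definite as well. *)

Set Implicit Arguments.
Unset Strict Implicit.
Unset Printing Implicit Defensive.

Import Order.TTheory GRing.Theory Num.Theory.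
Local Open Scope ring_scope.

(** * The moment functional of a sequence *)

Definition moment (R : comNzRingType) (u : nat -> R) (p : {poly R}) : R :=
  \sum_(i < size p) p`_i * u i.

Lemma moment_widen (R : comNzRingType) (u : nat -> R) (p : {poly R}) N :
  (size p <= N)%N -> moment u p = \sum_(i < N) p`_i * u i.
Proof.
move=> le_pN; rewrite /moment (big_ord_widen N (fun i => p`_i * u i)) //.
rewrite big_mkcond; apply: eq_bigr => i _; case: ltnP => // le_pi.
by rewrite nth_default // mul0r.
Qed.

Lemma moment_is_linear (R : comNzRingType) (u : nat -> R) :
  linear_for *%R (moment u).
Proof.
move=> a p q; pose N := maxn (size p) (size q).
have le_pN : (size p <= N)%N by rewrite leq_maxl.
have le_qN : (size q <= N)%N by rewrite leq_maxr.
rewrite (@moment_widen _ _ (a *: p + q) N); last first.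
  rewrite (leq_trans (size_polyD _ _)) // geq_max le_qN andbT.
  exact: leq_trans (size_scale_leq _ _) le_pN.
rewrite (moment_widen u le_pN) (moment_widen u le_qN) mulr_sumr -big_split /=.
by apply: eq_bigr => i _; rewrite coefD coefZ mulrDl mulrA.
Qed.

HB.instance Definition _ (R : comNzRingType) (u : nat -> R) :=
  GRing.isLinear.Build R {poly R} R _ (moment u) (moment_is_linear u).

Lemma momentD (R : comNzRingType) (u : nat -> R) :
  {morph moment u : p q / p + q}.
Proof. exact: linearD. Qed.

Lemma momentB (R : comNzRingType) (u : nat -> R) :
  {morph moment u : p q / p - q}.
Proof. exact: linearB. Qed.

Lemma momentZ (R : comNzRingType) (u : nat -> R) a p :
  moment u (a *: p) = a * moment u p.
Proof. exact: linearZ. Qed.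

Lemma momentXn (R : comNzRingType) (u : nat -> R) k : moment u 'X^k = u k.
Proof.
rewrite /moment size_polyXn big_ord_recr /= coefXn eqxx mul1r big1 ?add0r //.
by move=> i _; rewrite coefXn ltn_eqF ?ltn_ord // mul0r.
Qed.

(** The functional with moments z^k is evaluation at z, and a 2-periodic
    sequence is a combination of 1^k and (-1)^k. *)
Lemma moment_period2 (R : realFieldType) (u : nat -> R) :
  (forall k, u k = u (odd k)) -> forall p,
  moment u p = (u 0%N + u 1%N) / 2 * p.[1] + (u 0%N - u 1%N) / 2 * p.[-1].
Proof.
move=> u2 p; rewrite /moment !horner_coef !mulr_sumr -big_split /=.
apply: eq_bigr => i _; rewrite expr1n -signr_odd (u2 i).
by case: (odd i); rewrite ?expr0 ?expr1 /=; field.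
Qed.

Lemma moment_mulXn_period (R : comNzRingType) (u : nat -> R) r :
  (forall k, u (k + r)%N = u k) -> forall p, moment u (p * 'X^r) = moment u p.
Proof.
move=> ur p; rewrite -[p]coefK poly_def mulr_suml !linear_sum /=.
by apply: eq_bigr => i _; rewrite -scalerAl -exprD !momentZ !momentXn ur.
Qed.

(** Modulo X^4 - 1 the square of 1 - X^2 is 2 (1 - X^2), so its fourth power
    is 8 (1 - X^2). What remains is the real part of
    8 (w_0 - i w_1) (a + i b)^4, where w_k = u_k - u_{k+2}. *)
Lemma moment_antiperiodic_quartic (R : comNzRingType) (u : nat -> R) (a b : R) :
  (forall k, u (k + 4)%N = u k) ->
  moment u (((1 - 'X^2) * (a%:P + b *: 'X)) ^+ 4) =
  8 * ((u 0%N - u 2%N) * (a ^+ 4 - 6 * a ^+ 2 * b ^+ 2 + b ^+ 4)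
       + 4 * (u 1%N - u 3%N) * (a ^+ 3 * b - a * b ^+ 3)).
Proof.
move=> u4; rewrite exprMn; set G := (a%:P + _) ^+ 4.
(* (1 - X^2)^4 = 8 (1 - X^2) + (X^4 - 1) (X^4 - 4 X^2 + 7) *)
pose K := G * ('X^4 - 4 * 'X^2 + 7).
have -> : (1 - 'X^2) ^+ 4 * G = 8 *: (G - G * 'X^2) + (K * 'X^4 - K).
  by rewrite -mul_polyC /K rmorph_nat; ring.
rewrite momentD momentB moment_mulXn_period // subrr addr0 momentZ.
have GE : G - G * 'X^2 =
    (a ^+ 4) *: 'X^0 + (4 * a ^+ 3 * b) *: 'X^1
  + (6 * a ^+ 2 * b ^+ 2 - a ^+ 4) *: 'X^2
  + (4 * a * b ^+ 3 - 4 * a ^+ 3 * b) *: 'X^3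
  + (b ^+ 4 - 6 * a ^+ 2 * b ^+ 2) *: 'X^4
  - (4 * a * b ^+ 3) *: 'X^5 - (b ^+ 4) *: 'X^6.
  rewrite /G -!mul_polyC !(rmorphD, rmorphB, rmorphM, rmorphXn, rmorph_nat) /=.
  ring.
rewrite GE !(momentB, momentD) !momentZ !momentXn.
by rewrite (u4 0%N) (u4 1%N) (u4 2%N); ring.
Qed.

(** * Hankel forms as moments of powers *)

Definition col_poly (R : nzRingType) (n : nat) (x : 'cV[R]_n) : {poly R} :=
  \sum_(i < n) x i 0 *: 'X^i.

Lemma horner_col_poly (R : comNzRingType) n (x : 'cV[R]_n) z :
  (col_poly x).[z] = \sum_(i < n) z ^+ i * x i 0.
Proof.
rewrite /col_poly horner_sum; apply: eq_bigr => i _.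
by rewrite hornerZ hornerXn mulrC.
Qed.

Lemma col_poly_coef (R : comNzRingType) n (p : {poly R}) :
  (size p <= n)%N -> col_poly (\col_(i < n) p`_i) = p.
Proof.
move=> le_pn; rewrite -[RHS](coefK p) poly_def.
rewrite (big_ord_widen n (fun i => p`_i *: 'X^i)) // big_mkcond.
apply: eq_bigr => i _; rewrite mxE; case: ltnP => // le_pi.
by rewrite nth_default // scale0r.
Qed.

(** The sum of m indices below n is at most (n - 1) m, so only the range of v
    matters and u is free beyond it: u may be chosen periodic on all of nat,
    which makes reduction modulo X^r - 1 available without degree bounds. *)
Lemma hankel_poly_moment (R : realType) (m n : nat)
    (v : 'cV[R]_(n.-1 * m).+1) (u : nat -> R) :
  (forall k, (k <= n.-1 * m)%N -> entry v k = u k) ->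
  forall x : 'cV[R]_n, hankel_poly v x = moment u (col_poly x ^+ m).
Proof.
move=> vu x; rewrite -[m in col_poly x ^+ m]card_ord -prodr_const.
rewrite bigA_distr_bigA linear_sum /=.
apply: eq_bigr => f _; rewrite ffunE scaler_prod prodrXr momentZ momentXn.
rewrite mulrC vu //.
have -> : (n.-1 * m = \sum_(j < m) n.-1)%N by rewrite sum_nat_const card_ord mulnC.
by apply: leq_sum => j _; rewrite -ltnS (ltn_predK (ltn_ord (f j))).
Qed.

Lemma hankel_matrix_moment (R : realType) (m n : nat)
    (v : 'cV[R]_(n.-1 * m).+1) (u : nat -> R) :
  (forall k, (k <= n.-1 * m)%N -> entry v k = u k) ->
  forall y, (y^T *m hankel_matrix v *m y) 0 0 = moment u (col_poly y ^+ 2).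
Proof.
move=> vu y; rewrite mxE expr2 mulr_sumr linear_sum /=.
apply: eq_bigr => j _; rewrite mxE !mulr_suml linear_sum /=.
apply: eq_bigr => i _; rewrite !mxE.
rewrite -scalerAl -scalerAr -exprD !momentZ momentXn vu; first by ring.
have := ltn_ord i; have := ltn_ord j; have := odd_double_half m.
rewrite -muln2; nia.
Qed.

(** * The anti-circulant case *)

Lemma entry_mod_period (R : realType) (m n r : nat)
    (v : 'cV[R]_(n.-1 * m).+1) :
  generalized_anticirculant r v ->
  forall k, (k <= n.-1 * m)%N -> entry v k = entry v (k %% r).
Proof.
case=> _ vr k le_k.
rewrite [in LHS](divn_eq k r) addnC.
have : (k %% r + k %/ r * r <= n.-1 * m)%N by rewrite addnC -divn_eq.
elim: (k %/ r)%N => [|q IHq]; first by rewrite addn0.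
rewrite mulSnr addnA => le_q; rewrite -vr // IHq //; lia.
Qed.

Lemma psd_moment_ge0 (R : realType) (m n : nat)
    (v : 'cV[R]_(n.-1 * m).+1) (u : nat -> R) :
  (forall k, (k <= n.-1 * m)%N -> entry v k = u k) ->
  psd_tensor (hankel_tensor v) ->
  forall p : {poly R}, (size p <= n)%N -> 0 <= moment u (p ^+ m).
Proof.
move=> vu psd p le_pn; rewrite -(col_poly_coef le_pn) -(hankel_poly_moment vu).
exact: psd.
Qed.

Lemma psd_period4 (R : realType) (n : nat) (u : nat -> R) : (4 <= n)%N ->
  (forall k, u (k + 4)%N = u k) ->
  (forall p : {poly R}, (size p <= n)%N -> 0 <= moment u (p ^+ 4)) ->
  u 0%N = u 2%N /\ u 1%N = u 3%N.
Proof.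
move=> hn u4 psd.
have test (a b : R) : 0 <=
  (u 0%N - u 2%N) * (a ^+ 4 - 6 * a ^+ 2 * b ^+ 2 + b ^+ 4)
  + 4 * (u 1%N - u 3%N) * (a ^+ 3 * b - a * b ^+ 3).
  rewrite -(@pmulr_rge0 _ 8) // -moment_antiperiodic_quartic //.
  apply/psd/leq_trans/hn/(leq_trans (size_polyMleq _ _)).
  have s1 : (size (1 - 'X^2 : {poly R})%R <= 3)%N.
    by rewrite (leq_trans (size_polyD _ _)) // size_polyN size_polyXn size_poly1.
  have s2 : (size (a%:P + b *: 'X)%R <= 2)%N.
    rewrite (leq_trans (size_polyD _ _)) // geq_max.
    rewrite (leq_trans (size_polyC_leq1 _)) //.
    by rewrite (leq_trans (size_scale_leq _ _)) // size_polyX.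
  rewrite -subn1 leq_subLR; exact: leq_add s1 s2.
(* The fourth powers of 1 and 1 + i are 1 and -4; those of 2 + i and 2 - i
   are -7 + 24i and -7 - 24i. *)
have := test 1 0; have := test 1 1; have := test 2 1; have := test 2 (-1).
by move=> h1 h2 h3 h4; split; lra.
Qed.

Theorem theorem6 (R : realType) (n : nat) (hn : (4 <= n)%N)
    (v : 'cV[R]_(n.-1 * 4).+1) (hv : generalized_anticirculant 4 v) :
  (psd_tensor (hankel_tensor v) <->
     [/\ entry v 0 = entry v 2, entry v 1 = entry v 3 &
         `|entry v 1| <= entry v 0]) /\
  (psd_tensor (hankel_tensor v) ->
     [/\ exists t : R, 0 <= t <= 1 /\ entry v 1 = entry v 0 * (2 * t - 1),
         forall t : R, 0 <= t <= 1 -> entry v 1 = entry v 0 * (2 * t - 1) ->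
         forall x : 'cV[R]_n,
           hankel_poly v x =
             t * entry v 0 * (\sum_(i < n) x i 0) ^+ 4 +
             (1 - t) * entry v 0 * (\sum_(i < n) (-1) ^+ i * x i 0) ^+ 4 &
         strong_hankel v]).
Proof.
pose u k := entry v (k %% 4).
have vu : forall k, (k <= n.-1 * 4)%N -> entry v k = u k.
  exact: entry_mod_period hv.
have u4 k : u (k + 4)%N = u k by rewrite /u modnDr.
rewrite -[entry v 0]/(u 0%N) -[entry v 1]/(u 1%N) -[entry v 2]/(u 2%N).
rewrite -[entry v 3]/(u 3%N).
have u2 : u 0%N = u 2%N -> u 1%N = u 3%N -> forall k, u k = u (odd k).
  move=> u02 u13 k; have := ltn_pmod k (isT : (0 < 4)%N).
  rewrite -(odd_mod k (erefl : odd 4 = false)) -[u k]/(entry v (k %% 4)).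
  by case: (k %% 4)%N => [|[|[|[|]]]] //= _; rewrite ?u02 ?u13.
have iff : psd_tensor (hankel_tensor v) <->
    [/\ u 0%N = u 2%N, u 1%N = u 3%N & `|u 1%N| <= u 0%N].
  split=> [psd | [u02 u13 le_u10] x]; last first.
    rewrite -/(hankel_poly v x) (hankel_poly_moment vu) (moment_period2 (u2 u02 u13)).
    rewrite !horner_exp; move: le_u10; rewrite ler_norml => /andP[? ?].
    by rewrite addr_ge0 // mulr_ge0 ?exprn_even_ge0 //; lra.
  have psd_u := psd_moment_ge0 vu psd.
  have [u02 u13] := psd_period4 hn u4 psd_u; split=> //.
  (* X + 1 vanishes at -1 and X - 1 vanishes at 1, so each of them leaves a
     single weight. *)
  have test (c : R) : 0 <= moment u (('X + c%:P) ^+ 4).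
    by apply: psd_u; rewrite size_XaddC; lia.
  have := test 1; have := test (-1).
  rewrite !(moment_period2 (u2 u02 u13)) !horner_exp !(hornerD, hornerX, hornerC) => h1 h2.
  by rewrite ler_norml; apply/andP; split; lra.
split=> // /iff[u02 u13 le_u10]; have momE := moment_period2 (u2 u02 u13).
split.
(* If v_0 = 0 then v_1 = 0 too and every t works. *)
- have [u0|u0] := eqVneq (u 0%N) 0.
    exists 0; split; first by rewrite lexx ler01.
    by apply/eqP; move: le_u10; rewrite u0 mul0r normr_le0.
  exists ((u 1%N / u 0%N + 1) / 2); split; last by field.
  have u0_gt0 : 0 < u 0%N by rewrite lt_def u0 (le_trans _ le_u10).
  move: le_u10; rewrite ler_norml => /andP[ge1 le1].
  have : -1 <= u 1%N / u 0%N by rewrite ler_pdivlMr // mulN1r.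
  have : u 1%N / u 0%N <= 1 by rewrite ler_pdivrMr // mul1r.
  by move=> ? ?; apply/andP; split; lra.
- move=> t _ u1E x; rewrite (hankel_poly_moment vu) momE u1E !horner_exp.
  rewrite !horner_col_poly.
  under [in LHS]eq_bigr => i _ do rewrite expr1n mul1r.
  by congr (_ * _ + _ * _); field.
- split=> //; split; first by apply/matrixP=> i j; rewrite !mxE addnC.
  move=> y; rewrite (hankel_matrix_moment vu) momE !horner_exp.
  move: le_u10; rewrite ler_norml => /andP[? ?].
  by rewrite addr_ge0 // mulr_ge0 ?sqr_ge0 //; lra.
Qed.
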